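(* Let $n\ge 3$ and let $D_{2n}=\langle a,b: a^n=b^2=e,\ ab=ba^{-1}\rangle$ be the dihedral group of order $2n$. Then the characteristic polynomial of the distance matrix of the enhanced power graph of $D_{2n}$ is \[ \phi_D(\mathcal{G}_E(D_{2n}),x) = (x+2)^{n-1}(x+1)^{n-2}\big(x^3 - (3n-4)x^2-(2n^2+4n-5)x-n^2-2n+2\big). \]
   Context: For a group $G$, the enhanced power graph $\mathcal{G}_E(G)$ is the simple graph with vertex set $G$ in which distinct $a,b$ are adjacent if and only if $a,b\in\langle c\rangle$ for some $c\in G$. The distance matrix of a connected graph has $(u,v)$-entry equal to the graph distance $d(u,v)$ (and $0$ on the diagonal). $\phi_D(\Gamma,x)=\det(xI-D(\Gamma))$ is the characteristic polynomial of the distance matrix $D(\Gamma)$ of $\Gamma$. *)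

(* Defs.v *)
From HB Require Import structures.
From mathcomp Require Import all_boot all_order all_algebra all_fingroup.

Set Implicit Arguments.
Unset Strict Implicit.
Unset Printing Implicit Defensive.

Import GRing.Theory.

Definition enhanced_power_graph (gT : finGroupType) : rel gT :=
  [rel x y | (x != y) &&
     [exists c : gT, (x \in <[c]>%g) && (y \in <[c]>%g)]].

Definition has_walk (T : finType) (e : rel T) (x y : T) (k : nat) : bool :=
  [exists p : k.-tuple T, path e x p && (last x p == y)].

(* The length of a shortest walk from x to y. A shortest walk has no repeated
   vertex, hence length < #|T|; the value is #|T| when y is unreachable from x,
   which does not occur in a connected graph. *)
Definition gdist (T : finType) (e : rel T) (x y : T) : nat :=
  find (has_walk e x y) (iota 0 #|T|).

Definition distance_matrix (T : finType) (e : rel T) : 'M[int]_#|T| :=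
  \matrix_(i, j) Posz (gdist e (enum_val i) (enum_val j)).

Lemma enhanced_power_graph_sym (gT : finGroupType) :
  symmetric (@enhanced_power_graph gT).
Proof.
move=> x y; rewrite /enhanced_power_graph /= eq_sym; congr (_ && _).
by apply: eq_existsb => c; rewrite andbC.
Qed.

Lemma enhanced_power_graph_irr (gT : finGroupType) :
  irreflexive (@enhanced_power_graph gT).
Proof. by move=> x; rewrite /enhanced_power_graph /= eqxx. Qed.

Lemma enhanced_power_graph_connected (gT : finGroupType) (x y : gT) :
  connect (@enhanced_power_graph gT) x y.
Proof.
have c1 z : connect (@enhanced_power_graph gT) z 1%g.
  have [->|nz1] := eqVneq z 1%g; first exact: connect0.
  apply: connect1; rewrite /enhanced_power_graph /= nz1 /=; apply/existsP; exists z.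
  by rewrite cycle_id group1.
apply: connect_trans (c1 x) _.
by rewrite (sym_connect_sym (@enhanced_power_graph_sym gT)).
Qed.

Lemma gdistP (T : finType) (e : rel T) (x y : T) : connect e x y ->
  has_walk e x y (gdist e x y) /\
  (forall k, has_walk e x y k -> gdist e x y <= k).
Proof.
case/connectP=> p0 ep0 ->; case/shortenP: ep0 => p ep up _.
have wk : has_walk e x (last x p) (size p).
  by apply/existsP; exists (in_tuple p); rewrite /= ep eqxx.
have szp : size p < #|T|.
  by rewrite -[_.+1]/(size (x :: p)) -(card_uniqP up) max_card.
have hs : has (has_walk e x (last x p)) (iota 0 #|T|).
  by apply/hasP; exists (size p) => //; rewrite mem_iota.
have lt := hs; rewrite has_find size_iota in lt.
split; first by have := nth_find 0 hs; rewrite nth_iota.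
move=> k wk'; rewrite leqNgt; apply/negP => ltk.
have := before_find 0 ltk; rewrite nth_iota ?add0n ?wk' //.
exact: ltn_trans ltk lt.
Qed.

(* Main.v *)
(** Every element outside [C = <[a]>] is an involution, so the distance between
    distinct [x] and [y] is 1 if one of them is 1 or both lie in [C], and 2
    otherwise. Hence [xI - D] is constant on the classes [{1}], [C \ {1}] and
    [G \ C], up to a diagonal that is [x + 1] on [C] and [x + 2] outside. The
    determinant of such a matrix reduces to a 3 x 3 determinant over the classes,
    as [det (Delta + T V)] and [det (delta + V T)] agree up to [det Delta] and
    [det delta] whenever [Delta T = T delta]. *)

Require Import Defs.
From HB Require Import structures.
From mathcomp Require Import all_boot all_order all_algebra all_fingroup.
From mathcomp Require Import all_solvable.
From mathcomp Require Import zify ring.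

Import GRing.Theory.
Local Open Scope ring_scope.

Section DeterminantByClasses.

Variable R : comNzRingType.

(* Both sides are the determinant of the block matrix with rows [Delta, T] and
   [- V, 1], times [\det delta]: eliminate with the unit block, or with [Delta]. *)
Lemma det_add_intertwined (N m : nat) (Delta : 'M[R]_N) (delta : 'M[R]_m)
    (T : 'M[R]_(N, m)) (V : 'M[R]_(m, N)) :
  Delta *m T = T *m delta ->
  \det delta * \det (Delta + T *m V) = \det Delta * \det (delta + V *m T).
Proof.
move=> comT; pose W := block_mx Delta T (- V) 1%:M.
have EW : W *m block_mx 1%:M 0 V 1%:M = block_mx (Delta + T *m V) T 0 1%:M.
  by rewrite mulmx_block !mulmx1 !mulmx0 !mul1mx !add0r addNr.
have EW' : W *m block_mx 1%:M (- T) 0 delta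
           = block_mx Delta 0 (- V) (delta + V *m T).
  rewrite mulmx_block !mulmx1 !mulmx0 !mul1mx !addr0 mulmxN comT addNr.
  by rewrite mulNmx mulmxN opprK [X in block_mx _ _ _ X]addrC.
move/(congr1 determinant): EW; rewrite det_mulmx det_lblock det_ublock !det1 !mulr1.
move=> <-; rewrite -(det_lblock _ (- V)) -EW' det_mulmx det_ublock det1 mul1r.
by rewrite mulrC.
Qed.

(** Take for [T] the incidence matrix of indices against classes and [V = B *m T^T]. Then [T^T *m T]
    is diagonal with the class sizes as entries, which is where the cardinals on the right come
    from. The factor [\prod_k d k] stays on the left because [R] need not allow division. *)
Lemma det_diag_add_classes (N m : nat) (t : 'I_N -> 'I_m) (d : 'I_m -> R)
    (B : 'M[R]_m) :
  (\prod_k d k) * \det (\matrix_(i, j) (d (t i) *+ (i == j) + B (t i) (t j))) =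
  (\prod_i d (t i)) *
    \det (\matrix_(k, l) (d k *+ (k == l) + B k l *+ #|[pred i | t i == l]|)).
Proof.
pose T : 'M[R]_(N, m) := \matrix_(i, k) (t i == k)%:R.
pose Delta := diag_mx (\row_i d (t i)); pose delta := diag_mx (\row_k d k).
have TM p (A : 'M[R]_(m, p)) i j : (T *m A) i j = A (t i) j.
  rewrite mxE (bigD1 (t i)) //= mxE eqxx mul1r big1 ?addr0 // => k nk.
  by rewrite mxE eq_sym (negPf nk) mul0r.
have MT p (A : 'M[R]_(p, m)) i j : (A *m T^T) i j = A i (t j).
  rewrite mxE (bigD1 (t j)) //= !mxE eqxx mulr1 big1 ?addr0 // => k nk.
  by rewrite !mxE eq_sym (negPf nk) mulr0.
have comT : Delta *m T = T *m delta.
  apply/matrixP => i k; rewrite TM mul_diag_mx !mxE.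
  by case: eqP => [->|_]; rewrite ?mulr1 ?mulr0 ?mulr1n ?mulr0n.
have := @det_add_intertwined _ _ Delta delta T (B *m T^T) comT.
rewrite !det_diag; rewrite (eq_bigr d) => [|k _]; last by rewrite mxE.
rewrite [X in _ = X * _](eq_bigr (d \o t)) => [|i _]; last by rewrite mxE.
have -> : Delta + T *m (B *m T^T)
          = \matrix_(i, j) (d (t i) *+ (i == j) + B (t i) (t j)).
  by apply/matrixP => i j; rewrite mxE TM MT !mxE.
move=> ->; congr (_ * \det _); apply/matrixP => k l; rewrite !mxE; congr (_ + _).
under eq_bigr do rewrite MT mxE mulr_natr mulrb.
rewrite -big_mkcond (eq_bigr (fun=> B k l)) => [|i /eqP-> //]; exact: sumr_const.
Qed.

End DeterminantByClasses.

Section Distances.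

Variables (gT : finGroupType) (C : {group gT}).
Hypotheses (cycC : cyclic C) (invol : forall y, y \notin C -> (y ^+ 2 = 1)%g).

(* A generator outside [C] is an involution, so its cycle contains only one
   nontrivial element. *)
Lemma enhanced_power_graphE (x y : gT) :
  enhanced_power_graph x y =
  (x != y) && [|| x == 1%g, y == 1%g | (x \in C) && (y \in C)].
Proof.
rewrite /enhanced_power_graph /=; have [//|nxy] := eqVneq x y.
apply/existsP/idP => /=.
  case=> c /andP[xc yc]; case: (boolP (c \in C)) => cC.
    have sC : <[c]>%g \subset C by rewrite cycle_subG.
    by rewrite (subsetP sC _ xc) (subsetP sC _ yc) !orbT.
  have cyc2 z : z \in <[c]>%g -> z = 1%g \/ z = c.
    case/cycleP=> i ->; rewrite (divn_eq i 2) expgD mulnC expgM invol // expg1n mul1g.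
    by case: (i %% 2)%N (ltn_pmod i (isT : 0 < 2)%N) => [|[|]] // _; [left|right].
  case: (cyc2 _ xc) => [->|xE]; first by rewrite eqxx.
  by case: (cyc2 _ yc) => [->|yE]; rewrite ?eqxx ?orbT //; rewrite xE yE eqxx in nxy.
case/or3P => [/eqP->|/eqP->|].
- by exists y; rewrite group1 cycle_id.
- by exists x; rewrite group1 cycle_id.
by case/cyclicP: cycC => c -> cxy; exists c.
Qed.

(** Walks of length 0 and 1 are equality and adjacency, and the walk through the identity, adjacent
    to every other vertex, bounds all distances by 2. *)
Lemma gdist_enhanced_power_graph (x y : gT) :
  gdist (@enhanced_power_graph gT) x y =
  if x == y then 0%N
  else if [|| x == 1%g, y == 1%g | (x \in C) && (y \in C)] then 1%N else 2%N.
Proof.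
have [W minW] := gdistP (enhanced_power_graph_connected x y).
have walk1 u v : enhanced_power_graph u v = has_walk (@enhanced_power_graph gT) u v 1.
  apply/idP/existsP => [uv | [p]]; first by exists [tuple v]; rewrite /= uv eqxx.
  by case: p => -[|w [|]] //= _; rewrite andbT => /andP[uw /eqP<-].
have walk0 u v : (u == v) = has_walk (@enhanced_power_graph gT) u v 0.
  apply/idP/existsP => [uv | [p]]; first by exists [tuple]; rewrite /= uv.
  by case: p => -[].
have [xy|nxy] := ifPn; first by apply/eqP; rewrite -leqn0 minW // -walk0.
have gd0 : gdist (@enhanced_power_graph gT) x y != 0%N.
  by apply: contraNneq nxy => E; rewrite walk0 -E.
case: ifPn => adj.
  by apply/eqP; rewrite eqn_leq lt0n gd0 andbT minW // -walk1 enhanced_power_graphE nxy.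
have gd1 : gdist (@enhanced_power_graph gT) x y != 1%N.
  by apply: contraNneq adj => E; move: W; rewrite E -walk1 enhanced_power_graphE => /andP[].
have gd2 : (gdist (@enhanced_power_graph gT) x y <= 2)%N.
  case/norP: adj => x1 /norP[y1 _].
  apply/minW/existsP; exists [tuple 1%g; y].
  by rewrite /= !enhanced_power_graphE !eqxx x1 [(1%g : gT) == y]eq_sym y1 orbT.
by move: (gdist _ _ _) gd0 gd1 gd2 => [|[|[|]]].
Qed.

End Distances.

Lemma isoGrp_dihedral_structure (n : nat) (gT : finGroupType) : (1 < n)%N ->
  ([set: gT] \isog Grp (a : b : a ^+ n, b ^+ 2, a * b = b * a^-1))%g ->
  exists a : gT, [/\ #[a]%g = n, #|gT| = (2 * n)%N
    & forall y, y \notin <[a]>%g -> (y ^+ 2 = 1)%g].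
Proof.
move=> n1 hG.
have relE (rT : finGroupType) (x y : rT) :
  ((x * y == y * x^-1) = (x ^ y == x^-1))%g.
  by rewrite -(inj_eq (mulgI y^-1%g)) mulKg conjgE.
have homE (rT : finGroupType) (H : {group rT}) :
    (H \homg Grp (a : b : a ^+ n, b ^+ 2, a * b = b * a^-1))%g
    = (H \homg Grp (a : b : a ^+ n, b ^+ 2, a ^ b = a^-1))%g.
  apply/existsP/existsP => -[[a b] /=] ab; exists (a, b); move: ab;
  by rewrite !xpair_eqE /= relE.
(* Being given by a presentation determines which groups are homomorphic images. So each of the two
   groups is an image of the other, and their orders agree. *)
have hom_gT : ([set: gT] \homg [set: 'D_(n.*2)])%g.
  by rewrite (Grp_dihedral n1) -homE -hG homg_refl.
have hom_D : ([set: 'D_(n.*2)] \homg [set: gT])%g.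
  by rewrite hG homE -(Grp_dihedral n1) homg_refl.
have oG : #|[set: gT]| = (2 * n)%N.
  rewrite mul2n -(card_dihedral n1).
  by apply/eqP; rewrite eqn_leq !leq_homg.
have: ([set: gT] \homg Grp (a : b : a ^+ n, b ^+ 2, a ^ b = a^-1))%g.
  by rewrite -homE -hG homg_refl.
case/existsP=> -[a b] /= /eqP[defG an b2 ab].
have nab : (<[b]> \subset 'N(<[a]>))%g.
  by rewrite norms_cycle ab groupV cycle_id.
move: defG; rewrite /= norm_joinEr // => defG.
have oa : (#[a]%g %| n)%N by rewrite order_dvdn an.
have ob : (#[b]%g %| 2)%N by rewrite order_dvdn b2.
exists a; split; last first.
- move=> y ya; have: y \in (<[a]> * <[b]>)%g by rewrite defG inE.
  case/mulsgP=> c d ca /cycleP[j ->] yE; move: ya; rewrite yE.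
  rewrite (divn_eq j 2) expgD mulnC expgM b2 expg1n mul1g.
  case: (j %% 2)%N (ltn_pmod j (isT : 0 < 2)%N) => [|[|]] // _.
    by rewrite mulg1 ca.
  (* An element outside [<[a]>] is [c * b] with [b] inverting [c], so its square is
     [c * c^-1 * b ^+ 2]. *)
  have cb : (c ^ b = c^-1)%g by case/cycleP: ca => i ->; rewrite conjXg ab expVgn.
  move=> _; rewrite expgS expg1 [in X in (_ * X)%g]conjgC cb mulgA.
  by rewrite -(mulgA c b b) -[(b * b)%g]/(b ^+ 2)%g b2 mulg1 mulgV.
- by rewrite -cardsT.
(* The relations give only upper bounds on the orders of [a] and [b]; the [2 * n] elements of [<[a]>
   * <[b]>] force equality. *)
have := dvdn_leq (ltnW n1) oa; have := dvdn_leq (isT : 0 < 2)%N ob.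
have: (2 * n <= #[a]%g * #[b]%g)%N.
  by rewrite -oG -defG /order mul_cardG leq_pmulr // cardG_gt0.
by nia.
Qed.

Lemma det_mx33 (R : comNzRingType) (A : 'M[R]_3) :
  \det A = A 0 0 * (A 1 1 * A 2 2 - A 1 2 * A 2 1)
         - A 0 1 * (A 1 0 * A 2 2 - A 1 2 * A 2 0)
         + A 0 2 * (A 1 0 * A 2 1 - A 1 1 * A 2 0).
Proof.
(* Indexing by naturals identifies entries whose ordinals differ only in form after the cofactor
   expansion. *)
pose f (i j : nat) := A (inord i) (inord j).
have E i j : A i j = f i j by rewrite /f !inord_val.
rewrite (expand_det_row _ 0) !big_ord_recl big_ord0 /cofactor.
rewrite !(expand_det_row _ 0) !big_ord_recl !big_ord0 /cofactor !det_mx11 !mxE.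
rewrite !E /= /bump /= -[(1 %% 3)%N]/1%N -[((1 + 1) %% 3)%N]/2%N !(addn0, add0n) -[(1 + 1)%N]/2%N.
ring.
Qed.

Theorem theorem3p3 (n : nat) (hn : (3 <= n)%N) (gT : finGroupType)
    (hG : ([set: gT] \isog Grp (a : b : a ^+ n, b ^+ 2, a * b = b * a^-1))%g) :
  char_poly (distance_matrix (@enhanced_power_graph gT)) =
    ('X + 2%:P) ^+ (n - 1) * ('X + 1%:P) ^+ (n - 2) *
    ('X^3 - (3 * n%:Z - 4)%:P * 'X^2
      - (2 * n%:Z ^+ 2 + 4 * n%:Z - 5)%:P * 'X
      + (- n%:Z ^+ 2 - 2 * n%:Z + 2)%:P) :> {poly int}.
Proof.
have [a [oa oG invol]] := isoGrp_dihedral_structure n gT (ltnW hn) hG.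
pose t (x : gT) : 'I_3 := if x == 1%g then 0 else if x \in <[a]>%g then 1 else 2.
(* Chosen so that [d k + B k k = 'X]: [B] also puts minus the within-class distance on the diagonal,
   where the true distance is 0. *)
pose d (k : 'I_3) : {poly int} := if k == 2 then 'X + 2%:P else 'X + 1%:P.
pose B : 'M[{poly int}]_3 :=
  \matrix_(k, l) (if (k == 0) || (l == 0) || (k == 1) && (l == 1) then -1 else -2).
pose tt (i : 'I_#|gT|) := t (enum_val i).
have charE : char_poly_mx (distance_matrix (@enhanced_power_graph gT))
     = \matrix_(i, j) (d (tt i) *+ (i == j) + B (tt i) (tt j)).
  apply/matrixP => i j; rewrite !mxE.
  rewrite (gdist_enhanced_power_graph _ <[a]>%G (cycle_cyclic a) invol).
  rewrite (inj_eq enum_val_inj) /tt /t /=.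
  have [->|_] := eqVneq i j.
    rewrite orbb andbb mulr1n subr0; case: eqP => _ /=.
      by rewrite /d /= polyC1 addrK.
    by case: ifP => _; rewrite /d /= ?polyC1 ?addrK //; ring.
  rewrite !mulr0n !add0r; case: eqP => //= _; case: eqP => //= _.
    by rewrite orbT.
  have P2 : (Posz 2)%:P = 2 :> {poly int} by rewrite (polyC_natr _ 2).
  by do 2!case: (_ \in <[a]>%g); rewrite /= ?P2.
have cardE k : #|[pred i | tt i == k]| = #|[set x | t x == k]|.
  rewrite -!sum1_card [RHS](reindex (fun i : 'I_#|gT| => enum_val i)) /=; last first.
    exact/onW_bij/enum_val_bij.
  by apply: eq_bigl => i; rewrite !inE.
have c0 : #|[pred i | tt i == 0]| = 1%N.
  rewrite cardE -[RHS](cards1 (1%g : gT)); apply: eq_card => x; rewrite !inE /t.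
  by case: (x == 1%g) => //; case: (_ \in _).
have c2 : #|[pred i | tt i == 2]| = n.
  rewrite cardE.
  have -> : [set x | t x == 2] = ~: <[a]>%g.
    apply/setP=> x; rewrite !inE /t; have [->|_] := eqVneq x 1%g; first by rewrite group1.
    by case: (_ \in _).
  by apply: (@addnI #[a]%g); rewrite cardsC oG oa; lia.
have c1 : #|[pred i | tt i == 1]| = (n - 1)%N.
  rewrite cardE -oa /order (cardsD1 1%g <[a]>%g) group1 addKn.
  apply: eq_card => x; rewrite !inE /t; case: (x == 1%g) => //=.
  by case: (_ \in _).
have prod3 (F : 'I_3 -> {poly int}) : \prod_k F k = F 0 * F 1 * F 2.
  rewrite !big_ord_recl big_ord0 mulr1 mulrA.
  by congr (_ * F _ * F _); apply: val_inj.
have prodE : \prod_i d (tt i) = ('X + 2%:P) ^+ n * ('X + 1%:P) ^+ n.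
  have -> : \prod_i d (tt i) = \prod_k d k ^+ #|[pred i | tt i == k]|.
    rewrite (partition_big tt xpredT) //=; apply: eq_bigr => k _.
    rewrite (eq_bigr (fun=> d k)) => [|i /eqP-> //]; exact: prodr_const.
  rewrite prod3 c0 c1 c2 /d /= mulrC -exprD; congr (_ * _ ^+ _); lia.
have XC_neq0 (c : int) : 'X + c%:P != 0 by rewrite -size_poly_eq0 size_XaddC.
have := @det_diag_add_classes _ _ _ tt d B.
rewrite -charE -/(char_poly _) prodE prod3 det_mx33 !mxE c0 c1 c2 /d /=.
set P := char_poly _.
(* Removes the truncated subtractions: the exponents become [m.+1] and [m]. *)
have [m ->] : exists m, n = m.+2 by exists (n - 2)%N; lia.
rewrite !subSS !subn0.
rewrite !mulr1n !mulr0n.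
(* This is [\prod_k d k]; cancelling it lowers the exponents from [n] to [n - 2] and [n - 1]. *)
have nz : ('X + 1%:P) * ('X + 1%:P) * ('X + 2%:P) != 0 :> {poly int}.
  by rewrite !mulf_neq0.
move=> E; apply: (mulfI nz); rewrite {}E.
rewrite !(polyCD, polyCN, polyCM, polyC_exp, polyCB) -?natz -?pmulrn !polyC_natr !polyC1.
rewrite -![-2 *+ _]mulr_natr -![-1 *+ _]mulr_natr ![_ ^+ m.+2]exprS ![_ ^+ m.+1]exprS.
rewrite -[m.+2]addn2 -[m.+1]addn1 !natrD.
(* With [m] and the two powers generalized, a plain polynomial identity in ['X], [N], [u], [v]
   remains. *)
move: (m%:R : {poly int}) (('X + 1) ^+ m : {poly int})
  (('X + (1 + 1)) ^+ m : {poly int}) => N u v.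
ring.
Qed.
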